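(* Let $k\ge1$ and $n>k$ be integers, and let $0\le i\le n-k-1$. The number of truncated level-$(k,i)$ unified diagrams for $\mathrm{Car}^{(k)}_{n+1}$ equals $$T_k(n-k-1,i)=(n-k)^{i-1}\binom{k(n-k)+n-k-2-i}{n-k-1-i}.$$
   Context: Let $M=(k+1)(n-k)-2$ and let $\mathbf t=(t_1,\ldots,t_n)$ with $t_j=n-k$ for $1\le j\le k-1$, $t_k=n-k-1$, $t_j=1$ for $k+1\le j\le n-1$, $t_n=0$ (this is the vector of out-degrees minus one of $\mathrm{Car}^{(k)}_{n+1}$, the graph on $\{1,\ldots,n+1\}$ with edges $(i,i+1),(i,k+1),\ldots,(i,n)$ for $i\le k$ and $(i,i+1),(i,n+1)$ for $k+1\le i\le n$). Put $T_j=t_1+\cdots+t_j$. A truncated level-$(k,i)$ unified diagram is a triple $(\mathbf q,\kappa,\Gamma)$ where: (1) $\mathbf q=(q_{k+1},\ldots,q_n)$ is a weak composition of $i$ such that $(M-i)+q_{k+1}+\cdots+q_j\ge T_j$ for every $k\le j\le n$; (2) $\kappa$ is an ordered set partition $(B_{k+1},\ldots,B_n)$ of $\{1,\ldots,i\}$ with $|B_j|=q_j$ (equivalently, a labeling of the north steps of the path $N^{q_{k+1}}E\cdots N^{q_n}E$ by $1,\ldots,i$, increasing along consecutive north steps); (3) $\Gamma$ is a multiset of exactly $n-k-1-i$ pairs $(\ell,h)$ with $1\le \ell\le k$ and $0\le h\le n-k-2$ (the pair $(\ell,h)$ encodes the root $\alpha_\ell+\alpha_{\ell+1}+\cdots+\alpha_{k+h}$,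 a horizontal line segment of a gravity diagram from column $\ell$ to column $k+h$), such that for every $k+1\le j\le n-2$ the number of elements $(\ell,h)$ of $\Gamma$ (with multiplicity) having $k+h\ge j$ is at most $(M-i)+q_{k+1}+\cdots+q_j-T_j$. *)

(* Defs.v *)
From mathcomp Require Import all_boot all_order all_algebra.
From mathcomp Require Import zify.

Set Implicit Arguments.
Unset Strict Implicit.
Unset Printing Implicit Defensive.

(* Vertices and columns j are numbered from 1, as in the mathematics. *)

(* Car^(k)_{n+1}, on the vertices 1, ..., n+1. *)
Definition car_edge (k n a b : nat) : bool :=
  if a <= k then (b == a.+1) || (k < b <= n)
  else (a <= n) && ((b == a.+1) || (b == n.+1)).

Definition car_outdeg (k n a : nat) : nat :=
  count (car_edge k n a) (iota 1 n.+1).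

Definition car_t (k n j : nat) : nat :=
  if j < k then n - k
  else if j == k then n - k - 1
  else if j < n then 1
  else 0.

Lemma car_tE (k n j : nat) :
  0 < k < n -> 0 < j <= n -> car_t k n j = car_outdeg k n j - 1.
Proof.
move=> /andP[k0 kn] /andP[j0 jn].
have cnt a m N : count (fun b => a < b <= m) (iota 1 N) = minn N m - a.
  elim: N => [|N IH]; first by rewrite min0n.
  rewrite -[N.+1]addn1 iotaD count_cat IH /= add1n.
  by lia.
have ct1 c N : count (pred1 c) (iota 1 N) = (0 < c <= N) :> nat.
  by rewrite count_uniq_mem ?iota_uniq // mem_iota; lia.
have cntU (P : pred nat) c N : ~~ P c ->
    count (fun b => (b == c) || P b) (iota 1 N) =
    (0 < c <= N) + count P (iota 1 N).
  move=> Pc; rewrite -ct1 -count_predUI.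
  rewrite [X in _ + X](@eq_count _ _ pred0) ?count_pred0 ?addn0 //.
  by move=> b /=; case: eqVneq => // ->; apply: negbTE.
rewrite /car_t /car_outdeg.
have [N EN] : exists N, N = n.+1 by exists n.+1.
rewrite -EN /car_edge.
case: (ltngtP j k) => [jk|jk|->] /=.
- by rewrite (cntU (fun b => k < b <= n)); [rewrite cnt; lia | lia].
- rewrite jn /=; case: ltnP => jn'.
    by rewrite (cntU (pred1 n.+1)); [rewrite ct1; lia | rewrite /= eqSS; lia].
  have -> : j = n by lia.
  rewrite (@eq_count _ _ (pred1 n.+1)) ?ct1; first by lia.
  by move=> b /=; rewrite orbb.
- rewrite (@eq_count _ _ (fun b => k < b <= n)) ?cnt; first by lia.
  by move=> b /=; lia.
Qed.

Definition car_T (k n j : nat) : nat := \sum_(1 <= a < j.+1) car_t k n a.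

(* For 0 < k < n the subtraction is not truncated. *)
Definition car_M (k n : nat) : nat := (k + 1) * (n - k) - 2.

(* q a encodes the part q_{k+1+a}; every part of a weak composition of i is at
   most i, so taking the values in 'I_i.+1 is no restriction. *)
Definition composition_type (k n i : nat) := {ffun 'I_(n - k) -> 'I_i.+1}.

(* kappa a encodes the block B_{k+1+a}; the label s in {1, ..., i} is the
   ordinal s - 1. *)
Definition blocks_type (k n i : nat) := {ffun 'I_(n - k) -> {set 'I_i}}.

(* Multiplicity functions on pairs; the ordinal pair (l, h) stands for
   (l + 1, h), so h ranges over 0, ..., n-k-2 (no value when n = k + 1).
   A multiplicity never exceeds the size n-k-1-i of the multiset, so the bound
   on the values is no restriction. *)
Definition segments_type (k n i : nat) :=
  {ffun 'I_k * 'I_(n - k - 1) -> 'I_(n - k - 1 - i).+1}.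

Definition q_sum (k n i : nat) (q : composition_type k n i) (j : nat) : nat :=
  \sum_(a < n - k | k + 1 + a <= j) q a.

Definition valid_composition (k n i : nat) (q : composition_type k n i) : bool :=
  (\sum_a q a == i) &&
  [forall j : 'I_n.+1, (k <= j) ==>
     (car_T k n j <= (car_M k n - i) + q_sum q j)].

(* Blocks may be empty, so this is not [partition] of the set of blocks. *)
Definition valid_blocks (k n i : nat) (q : composition_type k n i)
    (kappa : blocks_type k n i) : bool :=
  [&& [forall a, #|kappa a| == q a],
      [forall a, forall b, (a != b) ==> [disjoint kappa a & kappa b]]
    & \bigcup_a kappa a == [set: 'I_i]].

(* The last subtraction is not truncated when q is valid. *)
Definition valid_segments (k n i : nat) (q : composition_type k n i)
    (Gamma : segments_type k n i) : bool :=
  (\sum_p Gamma p == n - k - 1 - i) &&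
  [forall j : 'I_n.+1, (k + 1 <= j) && (j + 2 <= n) ==>
     (\sum_(p : 'I_k * 'I_(n - k - 1) | j <= k + p.2) Gamma p
        <= (car_M k n - i) + q_sum q j - car_T k n j)].

Definition truncated_unified_diagrams (k n i : nat) :
    {set composition_type k n i * blocks_type k n i * segments_type k n i} :=
  [set d | [&& valid_composition d.1.1,
               valid_blocks d.1.1 d.1.2
             & valid_segments d.1.1 d.2]].

(* Main.v *)
(** Put [m = n - k].  Since [car_M - car_T j = max (m - 1 - (j - k)) 0], the
    conditions on a diagram say jointly that, for every [a < m], at most
    [m - 1 - a] of the [m - 1] labels and segments sit at position [>= a],
    where a label in block [B_(k+1+a)] and a segment [(l, a)] sit at position
    [a].  So a diagram is a parking function with [m - 1] cars, [i] of them
    labelled and the others an unlabelled multiset in [k] colours.  Letting the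
    positions range over [Z/m], each rotation orbit contains exactly one parking
    function by the cycle lemma, hence the count is [1/m] of the number
    [m^i * 'C(km + m - 2 - i, m - 1 - i)] of all configurations. *)

Require Import Defs.
From mathcomp Require Import all_boot all_order all_algebra.
From mathcomp Require Import zify.

Set Implicit Arguments.
Unset Strict Implicit.
Unset Printing Implicit Defensive.

(** * The cycle lemma *)

Section CycleLemma.

Variables (p : nat) (c : 'I_p.+1 -> nat).
Hypothesis sum_c : \sum_b c b = p.

(** Prefix sums of the periodic extension of [c] to [nat]: rotating [c] becomes sliding a window of
    length [p.+1]. *)
Let A (x : nat) : nat := \sum_(0 <= y < x) c (inZp y).

Let A_period (x : nat) : A (x + p.+1) = A x + p.
Proof.
elim: x => [|x IH].
  rewrite /A add0n [in RHS]big_geq // big_mkord -[RHS]sum_c.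
  by apply: eq_bigr => b _; congr c; apply: val_inj; rewrite /= modn_small.
rewrite addSn {1}/A big_nat_recr //= -/(A _) IH {2}/A big_nat_recr //= -/(A x).
suff -> : inZp (x + p.+1) = inZp x :> 'I_p.+1 by rewrite addnAC.
by apply: val_inj; rewrite /= modnDr.
Qed.

Let suffix_sum (r : 'I_p.+1) (a : nat) : a <= p ->
  \sum_(b : 'I_p.+1 | a <= b) c (b + r)%R + A (r + a) = A r + p.
Proof.
move=> le_ap; rewrite -A_period /A.
have -> : \sum_(b : 'I_p.+1 | a <= b) c (b + r)%R =
          \sum_(r + a <= y < r + p.+1) c (inZp y).
  rewrite [r + a]addnC [r + p.+1]addnC big_addn addnK.
  rewrite [RHS](big_nat_widenl _ 0) // big_mkord.
  apply: eq_big => b //= _; congr c; apply: val_inj => //=.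
rewrite addnC -big_cat_nat //=; lia.
Qed.

(** By [suffix_sum], [r] is good exactly when [A x - x] is minimal at [r] among [r, ..., r + p]. As
    [A x - x] drops by one per period, only its first minimum on [0, ..., p] qualifies. *)
Lemma cycle_lemma :
  #|[set r : 'I_p.+1 | [forall a : 'I_p.+1,
       \sum_(b : 'I_p.+1 | a <= b) c (b + r)%R <= p - a]]| = 1.
Proof.
have goodE (r : 'I_p.+1) :
    reflect (forall a, a <= p -> A r + a <= A (r + a))
    [forall a : 'I_p.+1, \sum_(b : 'I_p.+1 | a <= b) c (b + r)%R <= p - a].
  apply: (iffP forallP) => [H a le_ap | H a].
    by have := H (inord a); rewrite inordK //; have := suffix_sum r le_ap; lia.
  have le_ap : a <= p by rewrite -ltnS.
  by have := H a le_ap; have := suffix_sum r le_ap; lia.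
(* The good rotation starts at the first minimum of [A r - r]. *)
pose v (r : 'I_p.+1) := A r + (p - r).
(* As [r <= p], this weight compares the pairs [(v r, r)] lexicographically, so ties go to the
   smallest [r]; [v r] is [A r - r] shifted by [p] to stay in [nat]. *)
case: (@arg_minnP _ ord0 predT (fun r => v r * p.+1 + r)) => // r _ r_min.
have {}r_min (r' : 'I_p.+1) : v r + (r' < r) <= v r'.
  have := r_min r' isT; have := ltn_ord r; have := ltn_ord r'.
  by case: (ltnP r' r) => /=; nia.
apply/eqP/cards1P; exists r; apply/setP => r'; rewrite !inE.
apply/goodE/eqP => [r'_good | -> a le_ap]; last first.
  have r_lt := ltn_ord r.
  (* Beyond the wrap [A x - x] is one lower than a period before; strict minimality against
     positions before [r] makes up for it. *)
  case: (ltnP (r + a) p.+1) => [lt_p | ge_p].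
    by have := r_min (Ordinal lt_p); rewrite /v /=; lia.
  have lt_p : r + a - p.+1 < p.+1 by lia.
  have := r_min (Ordinal lt_p); rewrite /v /=.
  have := A_period (r + a - p.+1); rewrite subnK //; lia.
have r_lt := ltn_ord r; have r'_lt := ltn_ord r'.
have := r_min r'; rewrite /v => min_r'.
(* A good [r'] other than [r] is compared with the next copy of [r]: [r] itself, or [r + p.+1],
   where [A x - x] is one lower. *)
apply: val_inj => /=; case: (ltngtP r' r) => // lt_rr.
  have := r'_good (r - r'); rewrite subnKC; lia.
have := r'_good (r + p.+1 - r'); rewrite subnKC; last lia.
have := A_period r; lia.
Qed.

End CycleLemma.

(** * Stars and bars, and fibre sizes *)

Lemma card_multiset (T : finType) (s : nat) : 0 < #|T| ->
  #|[set G : {ffun T -> 'I_s.+1} | \sum_x G x == s :> nat]|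
    = 'C(#|T| + s - 1, s).
Proof.
case E: #|T| => [//|t] _.
have -> : t.+1 + s - 1 = t + s by lia.
have -> : 'C(t + s, s) = 'C(t + s, t) by rewrite -[LHS]bin_sub ?leq_addl // addnK.
(* [card_ord_partitions] counts tuples with a given sum; [fgraph] carries multiplicity functions to
   such tuples. *)
rewrite -card_ord_partitions -E.
rewrite -(card_imset _ (can_inj (@fgraphK T 'I_s.+1))).
congr #|pred_of_set _|; apply/setP => u; rewrite inE.
have sumE (G : {ffun T -> 'I_s.+1}) : \sum_(j <- fgraph G) j = \sum_x G x.
  by rewrite fgraph_codom big_image.
apply/imsetP/idP => [[G + ->] | u_sum]; first by rewrite inE sumE.
by exists (Finfun u); rewrite ?FinfunK // inE -sumE FinfunK.
Qed.

Lemma sum_card_fibres (S T : finType) (f : {ffun S -> T}) (P : pred T) :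
  \sum_(b | P b) #|f @^-1: [set b]| = #|[set c | P (f c)]|.
Proof.
rewrite -sum1dep_card (partition_big f P) //=.
apply: eq_bigr => b Pb; rewrite -sum1_card; apply: eq_bigl => c.
by rewrite !inE; case: eqP => [->|_]; rewrite ?Pb ?andbF.
Qed.

(** * Parking configurations and their rotations *)

Section ParkingConfigurations.

Variables k i s : nat.

(* [i] labelled cars and a multiset of cars of [k] colours, each preferring one
   of [m] spots; the size [s] of the multiset is imposed in [configurations]. *)
Definition configuration (m : nat) : finType :=
  ({ffun 'I_i -> 'I_m} * {ffun 'I_k * 'I_m -> 'I_s.+1})%type.

Definition content (m : nat) (x : configuration m) (b : 'I_m) : nat :=
  #|x.1 @^-1: [set b]| + \sum_l x.2 (l, b).

Definition labelled_from (m : nat) (x : configuration m) (a : nat) : nat :=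
  #|[set c | a <= x.1 c]|.

Definition coloured_from (m : nat) (x : configuration m) (a : nat) : nat :=
  \sum_(y : 'I_k * 'I_m | a <= y.2) x.2 y.

Definition configurations (m : nat) : {set configuration m} :=
  [set x : configuration m | \sum_y x.2 y == s :> nat].

(** Suffix form of the parking condition. The bound at [a = m - 1] is zero: no car prefers the last
    spot, which serves to close the circle. *)
Definition parking (m : nat) (x : configuration m) : bool :=
  [forall a : 'I_m, \sum_(b : 'I_m | a <= b) content x b <= m - 1 - a].

Lemma sum_content (m : nat) (x : configuration m) (P : pred 'I_m) :
  \sum_(b | P b) content x b =
  #|[set c | P (x.1 c)]| + \sum_(y | P y.2) x.2 y.
Proof.
rewrite big_split /= sum_card_fibres; congr (_ + _).
rewrite exchange_big pair_big /=.
by apply: eq_big => [[l b]|[l b] _].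
Qed.

Lemma card_configurations (m : nat) : 0 < k * m ->
  #|configurations m| = m ^ i * 'C(k * m + s - 1, s).
Proof.
move=> km_gt0.
have -> : configurations m = setX setT
    [set G : {ffun 'I_k * 'I_m -> 'I_s.+1} | \sum_y G y == s :> nat].
  by apply/setP => x; rewrite !inE.
by rewrite cardsX cardsT card_ffun !card_ord card_multiset card_prod !card_ord.
Qed.

Section Rotation.

Variable p : nat.

(** Both components move every car back by [r]; spots are values of [x.1] but arguments of [x.2],
    whence the opposite signs. *)
Definition rotate (r : 'I_p.+1) (x : configuration p.+1) :
    configuration p.+1 :=
  ([ffun c => x.1 c - r], [ffun y => x.2 (y.1, y.2 + r)])%R.

Lemma rotateK (r : 'I_p.+1) : cancel (rotate r) (rotate (- r)%R).
Proof.
move=> [f G]; congr (_, _); apply/ffunP.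
  by move=> c; rewrite !ffunE /= GRing.opprK GRing.subrK.
by move=> [l b]; rewrite !ffunE /= GRing.addrNK.
Qed.

Lemma content_rotate (r b : 'I_p.+1) (x : configuration p.+1) :
  content (rotate r x) b = content x (b + r)%R.
Proof.
rewrite /content /=; congr (_ + _).
  by apply: eq_card => c; rewrite !inE ffunE GRing.subr_eq.
by apply: eq_bigr => l _; rewrite ffunE.
Qed.

Lemma mem_configurationsE (x : configuration p.+1) :
  (x \in configurations p.+1) = (\sum_b content x b == i + s).
Proof.
rewrite inE sum_content.
have -> : [set c | predT (x.1 c)] = [set: 'I_i] by apply/setP => c; rewrite !inE.
by rewrite cardsT card_ord eqn_add2l.
Qed.

Lemma rotate_configurations (r : 'I_p.+1) (x : configuration p.+1) :
  (rotate r x \in configurations p.+1) = (x \in configurations p.+1).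
Proof.
rewrite !mem_configurationsE; congr (_ == _).
under eq_bigr do rewrite content_rotate.
by rewrite [RHS](reindex_inj (GRing.addIr r)).
Qed.

(* Pollak's argument: every rotation orbit of configurations contains exactly
   one parking configuration. *)
Lemma card_parking_rotations : i + s = p ->
  p.+1 * #|[set x in configurations p.+1 | parking x]|
    = #|configurations p.+1|.
Proof.
move=> is_p.
rewrite -[RHS]sum1_card.
have one x : x \in configurations p.+1 -> \sum_r (parking (rotate r x) : nat) = 1.
  rewrite mem_configurationsE is_p => /eqP /cycle_lemma <-.
  rewrite -sum1dep_card [RHS]big_mkcond; apply: eq_bigr => r _.
  suff -> : parking (rotate r x) = [forall a : 'I_p.+1,
      \sum_(b : 'I_p.+1 | a <= b) content x (b + r)%R <= p - a] by case: ifP.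
  apply: eq_forallb => a; rewrite subn1 /=; congr (_ <= _).
  by apply: eq_bigr => b _; rewrite content_rotate.
(* Double counting of the pairs [(r, x)] with [rotate r x] parking: each [x] has one [r], and for
   each [r] rotation permutes the configurations. *)
rewrite -(eq_bigr _ one) exchange_big /=.
rewrite (eq_bigr (fun=> #|[set x in configurations p.+1 | parking x]|)).
  by rewrite sum_nat_const card_ord.
move=> r _; rewrite -sum1dep_card.
rewrite [RHS](reindex_inj (can_inj (rotateK r))) /=.
under [RHS]eq_bigl do rewrite rotate_configurations.
by rewrite big_mkcondr; apply: eq_bigr => x _; case: ifP.
Qed.

End Rotation.

Lemma card_parking (m : nat) : 0 < k -> 0 < m -> i + s = m - 1 ->
  m * #|[set x in configurations m | parking x]|
    = m ^ i * 'C(k * m + s - 1, s).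
Proof.
case: m => // p k_gt0 _; rewrite subn1 => /card_parking_rotations ->.
by rewrite card_configurations // muln_gt0 k_gt0.
Qed.

End ParkingConfigurations.

(** * Partial sums of the out-degree vector *)

Lemma car_ME (k n j : nat) : 0 < k < n -> k <= j <= n ->
  car_M k n = car_T k n j + (n - j - 1).
Proof.
move=> /andP[k_gt0 lt_kn] /andP[le_kj le_jn].
have TS a : car_T k n a.+1 = car_T k n a + car_t k n a.+1.
  by rewrite /car_T big_nat_recr.
have T_lt a : a < k -> car_T k n a = a * (n - k).
  elim: a => [|a IH] lt_ak; first by rewrite /car_T big_geq.
  by rewrite TS IH ?mulSn ?(ltnW lt_ak) // /car_t lt_ak addnC.
have T_k : car_T k n k + 1 = k * (n - k).
  case: (k) k_gt0 lt_kn T_lt TS => // k' _ lt_kn T_lt TS.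
  rewrite TS T_lt // /car_t ltnn eqxx mulSn; lia.
(* Beyond [k] the sum grows by one per column and stalls at column [n], where [car_t] is 0; hence
   the [minn]. *)
have T_ge a : k + a <= n -> car_T k n (k + a) = car_T k n k + minn a (n - k - 1).
  elim: a => [|a IH] le_n; first by rewrite addn0 min0n addn0.
  rewrite addnS TS IH /car_t; last lia.
  case: ifP => ?; first lia.
  case: eqP => ?; first lia.
  case: ifP; lia.
have := T_ge (j - k); rewrite subnKC // => /(_ le_jn) ->.
rewrite /car_M mulnDl mul1n -T_k; lia.
Qed.

(** * Diagrams as parking configurations *)

Section DiagramsAsParkingConfigurations.

Variables k n i : nat.
Hypotheses (k_gt0 : 0 < k) (lt_kn : k < n) (le_i : i <= n - k - 1).

Let conf := configuration k i (n - k - 1 - i) (n - k).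

Definition widen_column : 'I_(n - k - 1) -> 'I_(n - k) :=
  widen_ord (leq_subr 1 (n - k)).

Definition composition_of (x : conf) : composition_type k n i :=
  [ffun a => inord #|x.1 @^-1: [set a]|].

Definition blocks_of (x : conf) : blocks_type k n i :=
  [ffun a => x.1 @^-1: [set a]].

Definition segments_of (x : conf) : segments_type k n i :=
  [ffun y => x.2 (y.1, widen_column y.2)].

Definition diagram_of (x : conf) :
    composition_type k n i * blocks_type k n i * segments_type k n i :=
  (composition_of x, blocks_of x, segments_of x).

(** This concerns coloured cars only: [x.2] is the extension by zero of its segments, so
    [segments_of] loses nothing. *)
Definition no_car_on_last_spot (x : conf) : Prop :=
  forall (l : 'I_k) (h : 'I_(n - k)), n - k - 1 <= h -> x.2 (l, h) = ord0.

Lemma composition_ofE (x : conf) (a : 'I_(n - k)) :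
  composition_of x a = #|x.1 @^-1: [set a]| :> nat.
Proof.
by rewrite ffunE inordK // ltnS -[X in _ <= X]card_ord max_card.
Qed.

(** Block [k + 1 + b] lies in columns up to [k + a] exactly when [b < a], so prefix sums of [q]
    complement the suffix counts of labels. *)
Lemma q_sum_composition_of (x : conf) (a : nat) :
  q_sum (composition_of x) (k + a) + labelled_from x a = i.
Proof.
rewrite /q_sum /labelled_from; under eq_bigr do rewrite composition_ofE.
rewrite sum_card_fibres -[RHS]card_ord.
rewrite -[RHS](cardsC [set c | a <= x.1 c]) addnC; congr (_ + _).
by apply: eq_card => c; rewrite !inE -ltnNge -addnA leq_add2l add1n.
Qed.

Lemma sum_segments_of (x : conf) (a : nat) : no_car_on_last_spot x ->
  \sum_(y : 'I_k * 'I_(n - k - 1) | a <= y.2) segments_of x y =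
  coloured_from x a.
Proof.
move=> last0.
transitivity (\sum_l \sum_(h < n - k - 1 | a <= h) (x.2 (l, widen_column h) : nat)).
  rewrite pair_big; apply: eq_big => [[l h]|[l h] _] //=.
  by rewrite ffunE.
transitivity (\sum_l \sum_(h < n - k | a <= h) (x.2 (l, h) : nat)); last first.
  by rewrite pair_big; apply: eq_big => [[l h]|[l h] _].
apply: eq_bigr => l _.
rewrite [RHS](bigID (fun h : 'I_(n - k) => h < n - k - 1)) /=.
rewrite [X in _ + X]big1 ?addn0.
  by rewrite (big_ord_narrow_cond (leq_subr 1 (n - k))).
by move=> h /andP[_]; rewrite -leqNgt => /last0 ->.
Qed.

Lemma valid_blocks_of (x : conf) :
  valid_blocks (composition_of x) (blocks_of x).
Proof.
apply/and3P; split.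
- by apply/forallP => a; rewrite composition_ofE ffunE.
- apply/forallP => a; apply/forallP => b; apply/implyP => neq_ab.
  rewrite -setI_eq0; apply/eqP/setP => c; rewrite !ffunE !inE.
  by apply: contraNF neq_ab => /andP[/eqP <- /eqP <-].
- apply/eqP/setP => c; rewrite inE; apply/bigcupP; exists (x.1 c) => //.
  by rewrite ffunE !inE.
Qed.

(** The fibres of [x.1] always have total size [i]; by [q_sum_composition_of] and [car_ME] the path
    condition at [j = k + a] is the suffix bound at [a]. *)
Lemma valid_composition_of (x : conf) :
  reflect (forall a, a <= n - k -> labelled_from x a <= n - k - 1 - a)
    (valid_composition (composition_of x)).
Proof.
have -> : valid_composition (composition_of x) =
    [forall j : 'I_n.+1, (k <= j) ==>
     (car_T k n j <= (car_M k n - i) + q_sum (composition_of x) j)].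
  rewrite /valid_composition; under eq_bigr do rewrite composition_ofE.
  rewrite sum_card_fibres.
  have -> : [set c | predT (x.1 c)] = [set: 'I_i] by apply/setP => c; rewrite !inE.
  by rewrite cardsT card_ord eqxx.
have k_bounds : 0 < k < n by rewrite k_gt0.
(* This gives [i <= car_M k n], so that [car_M k n - i] is not truncated. *)
have Mk : car_M k n = car_T k n k + (n - k - 1) by apply: car_ME; lia.
apply: (iffP forallP) => [H a le_a | H j].
  have lt_j : k + a < n.+1 by lia.
  have /implyP/(_ (leq_addr _ _)) /= := H (Ordinal lt_j).
  have := q_sum_composition_of x a.
  have : car_M k n = car_T k n (k + a) + (n - (k + a) - 1).
    by apply: car_ME; lia.
  lia.
apply/implyP => le_kj; have le_jn := ltn_ord j.
have le_j : j - k <= n - k by lia.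
have := H _ le_j; have := q_sum_composition_of x (j - k).
have : car_M k n = car_T k n j + (n - j - 1) by apply: car_ME; lia.
rewrite subnKC //; lia.
Qed.

Lemma valid_segments_of (x : conf) : no_car_on_last_spot x ->
  reflect (x \in configurations k i (n - k - 1 - i) (n - k) /\
           forall a, 0 < a -> a + 2 <= n - k ->
             coloured_from x a
               <= n - k - 1 - a - labelled_from x a)
    (valid_segments (composition_of x) (segments_of x)).
Proof.
move=> last0; rewrite /valid_segments.
have k_bounds : 0 < k < n by rewrite k_gt0.
have Mk : car_M k n = car_T k n k + (n - k - 1) by apply: car_ME; lia.
have -> : \sum_y segments_of x y = \sum_y x.2 y :> nat.
  exact: sum_segments_of 0 last0.
have sumE (j : nat) : k <= j ->
    \sum_(y : 'I_k * 'I_(n - k - 1) | j <= k + y.2) segments_of x y =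
    coloured_from x (j - k).
  move=> le_kj; rewrite -sum_segments_of //.
  by apply: eq_bigl => y; rewrite leq_subLR.
rewrite [in X in reflect X]inE.
apply: (iffP andP) => -[x_sum H]; split=> //.
  move=> a a_gt0 le_a; have lt_j : k + a < n.+1 by lia.
  move/forallP/(_ (Ordinal lt_j))/implyP: H => /= /(_ ltac:(lia)).
  rewrite sumE ?leq_addr // addKn.
  have := q_sum_composition_of x a.
  have : car_M k n = car_T k n (k + a) + (n - (k + a) - 1).
    by apply: car_ME; lia.
  lia.
apply/forallP => j; apply/implyP => /andP[lt_kj lt_jn].
have le_kj : k <= j by lia.
rewrite sumE //; have := H (j - k) ltac:(lia) ltac:(lia); have := q_sum_composition_of x (j - k).
have : car_M k n = car_T k n j + (n - j - 1) by apply: car_ME; lia.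
rewrite subnKC //; lia.
Qed.

Lemma parking_no_car_on_last_spot (x : conf) :
  parking x -> no_car_on_last_spot x.
Proof.
move=> /forallP x_park l h le_h; apply: val_inj => /=.
have := x_park h; rewrite sum_content (bigD1 (l, h)) //=.
have := ltn_ord h; lia.
Qed.

Lemma diagram_of_truncated (x : conf) : no_car_on_last_spot x ->
  (diagram_of x \in truncated_unified_diagrams k n i) =
  (x \in configurations k i (n - k - 1 - i) (n - k)) && parking x.
Proof.
move=> last0; rewrite inE valid_blocks_of /=.
have parkE : parking x <-> forall a, a < n - k ->
    labelled_from x a + coloured_from x a
      <= n - k - 1 - a.
  split=> [/forallP H a lt_a | H].
    by have := H (Ordinal lt_a); rewrite sum_content.
  by apply/forallP => a; rewrite sum_content; apply: H.
apply/andP/andP => -[].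
  move=> /valid_composition_of comp /(valid_segments_of last0).
  move=> [x_conf segs]; split=> //; apply/parkE => a lt_a.
  have := comp a (ltnW lt_a).
  (* The segment condition covers only [0 < a <= n - k - 2]. At [a = 0] the total number of cars
     gives the bound; at [a = n - k - 1] there are no coloured cars. *)
  case: (posnP a) => [-> _ | a_gt0].
    have -> : labelled_from x 0 = i.
      by rewrite -[RHS]card_ord -cardsT; apply: eq_card => c; rewrite !inE.
    have -> : coloured_from x 0 = n - k - 1 - i.
      by move: x_conf; rewrite inE => /eqP.
    by lia.
  case: (leqP (a + 2) (n - k)) => [le_a | gt_a].
    by have := segs a a_gt0 le_a; lia.
  rewrite /coloured_from big1 ?addn0 // => -[l h] /= le_h.
  by rewrite last0 //; lia.
move=> x_conf /parkE x_park; split.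
  apply/valid_composition_of => a le_a.
  have [lt_a | ge_a] := ltnP a (n - k); first by have := x_park a lt_a; lia.
  rewrite /labelled_from (_ : [set c | _] = set0) ?cards0 //.
  apply/setP => c; rewrite !inE; have := ltn_ord (x.1 c); lia.
apply/(valid_segments_of last0); split=> // a a_gt0 le_a.
by have := x_park a ltac:(lia); lia.
Qed.

Lemma diagram_of_inj (x y : conf) :
  no_car_on_last_spot x -> no_car_on_last_spot y ->
  diagram_of x = diagram_of y -> x = y.
Proof.
case: x y => [f G] [f' G'] last0 last0' [_ /ffunP eq_blocks /ffunP eq_segs].
congr (_, _); apply/ffunP.
  move=> c; have := eq_blocks (f c); rewrite !ffunE => /setP/(_ c).
  by rewrite !inE eqxx => /esym/eqP.
move=> [l h]; have [lt_h | ge_h] := ltnP h (n - k - 1).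
  have := eq_segs (l, Ordinal lt_h); rewrite !ffunE /=.
  by rewrite (_ : widen_column _ = h) //; apply: val_inj.
by have := last0 l h ge_h; have := last0' l h ge_h => /= -> ->.
Qed.

Lemma diagram_of_surj d : d \in truncated_unified_diagrams k n i ->
  exists2 x : conf, no_car_on_last_spot x & diagram_of x = d.
Proof.
case: d => [[q kappa] Gamma]; rewrite inE /= => /and3P[_ + _].
case/and3P => /forallP card_kappa /forallP disj /eqP cover_kappa.
have in_block c : {a | c \in kappa a}.
  apply: sigW; have : c \in [set: 'I_i] by [].
  by rewrite -cover_kappa => /bigcupP[a _ ca]; exists a.
pose f : {ffun 'I_i -> 'I_(n - k)} := [ffun c => sval (in_block c)].
have fE a : f @^-1: [set a] = kappa a.
  apply/setP => c; rewrite !inE ffunE; case: (in_block c) => b /= cb.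
  apply/eqP/idP => [<- // | ca]; apply/eqP; apply: contraTT cb => neq_ba.
  have /forallP/(_ a)/implyP/(_ neq_ba) := disj b.
  by rewrite disjoint_sym => /disjointFr ->.
(* Extension by zero: [insub] fails exactly on the last spot, and [oapp] then returns [ord0]. *)
pose G : {ffun 'I_k * 'I_(n - k) -> 'I_(n - k - 1 - i).+1} :=
  [ffun y => oapp (fun h => Gamma (y.1, h)) ord0 (insub (val y.2))].
exists (f, G).
  move=> l h le_h; rewrite ffunE /= insubF //; lia.
congr (_, _, _); apply/ffunP.
- move=> a; apply: val_inj; rewrite /= composition_ofE /= fE.
  exact/eqP.
- by move=> a; rewrite ffunE /= fE.
- by move=> [l h]; rewrite !ffunE /= valK.
Qed.

Lemma card_truncated_unified_diagrams :
  #|truncated_unified_diagrams k n i| =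
  #|[set x : conf | (x \in configurations k i (n - k - 1 - i) (n - k))
                    && parking x]|.
Proof.
rewrite -[RHS](card_in_imset (f := diagram_of)); last first.
  move=> x y; rewrite !inE => /andP[_ x_park] /andP[_ y_park].
  by apply: diagram_of_inj; apply: parking_no_car_on_last_spot.
congr #|pred_of_set _|; apply/setP => d; apply/idP/imsetP.
  move=> d_diag; have [x last0 def_d] := diagram_of_surj d_diag.
  by exists x; rewrite // inE -diagram_of_truncated ?def_d.
case=> x; rewrite inE => x_good ->.
by rewrite diagram_of_truncated //; case/andP: x_good => _ /parking_no_car_on_last_spot.
Qed.

End DiagramsAsParkingConfigurations.

(** * The closed formula over the rationals *)

Local Open Scope ring_scope.

Theorem theorem3p20 (k n i : nat) (hk : (1 <= k)%N) (hn : (k < n)%N)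
    (hi : (i <= n - k - 1)%N) :
  (#|truncated_unified_diagrams k n i|%:R : rat) =
  ((n - k)%N%:R : rat) ^ (i%:Z - 1) *
  'C(k * (n - k) + (n - k) - 2 - i, n - k - 1 - i)%:R.
Proof.
rewrite card_truncated_unified_diagrams //.
have m_gt0 : (0 < n - k)%N by rewrite subn_gt0.
have m_neq0 : (n - k)%N%:R != 0 :> rat by rewrite Num.Theory.pnatr_eq0 -lt0n.
have := @card_parking k i (n - k - 1 - i) (n - k) hk m_gt0 (subnKC hi).
have -> : (k * (n - k) + (n - k - 1 - i) - 1 = k * (n - k) + (n - k) - 2 - i)%N.
  by lia.
move=> /(congr1 (fun N : nat => N%:R : rat)); rewrite !GRing.natrM GRing.natrX.
(* Multiplying by [n - k] matches [card_parking] and turns the exponent [i - 1], which is -1 at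
   [i = 0], into [i]. *)
move=> card_eq; apply: (GRing.mulfI m_neq0).
rewrite card_eq GRing.mulrA; congr (_ * _).
by rewrite exprnP -[in LHS](GRing.subrK 1 i%:Z) expfzDr // expr1z GRing.mulrC.
Qed.
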